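(* Let $\vec a(s_a)$ and $\vec b(s_b)$ be two Cartan framed null curves in Minkowski 3-space $E_1^3$, with curvatures $\kappa_a,\kappa_b$ (nowhere zero, so that the quotients below make sense) and torsions $\tau_a,\tau_b$. Then $\vec a$ and $\vec b$ are null similar curves with variable transformation if and only if the ratios of their curvatures are the same, i.e. $$\frac{\tau_b(s_b)}{\kappa_b(s_b)}=\frac{\tau_a(s_a)}{\kappa_a(s_a)}$$ at all corresponding parameter values, under the particular variable transformation of the arc lengths keeping equal total curvatures, i.e. $$\varphi_b(s_b)=\int\kappa_b(s_b)\,ds_b=\int\kappa_a(s_a)\,ds_a=\varphi_a(s_a).$$
   Context: $E_1^3$ is $\mathbb R^3$ with the Lorentz metric $\langle\cdot,\cdot\rangle=-dx_1^2+dx_2^2+dx_3^2$ and vector product $\vec x\times\vec y=(x_2y_3-x_3y_2,\;x_1y_3-x_3y_1,\;x_2y_1-x_1y_2)$. A vector $\vec v\neq0$ is null if $\langle\vec v,\vec v\rangle=0$. A Cartan framed null curve (null Frenet curve) $\vec a=\vec a(s)$ is a curve admitting a frame field $\{\vec\alpha,\vec\gamma,\vec\beta\}$ and functions $\kappa$ (curvature), $\tau$ (torsion) with $\vec\alpha=d\vec a/ds$, $\langle\vec\alpha,\vec\alpha\rangle=\langle\vec\gamma,\vec\gamma\rangle=0$, $\langle\vec\beta,\vec\beta\rangle=\langle\vec\alpha,\vec\gamma\rangle=1$, $\vec\beta=\vec\alpha\times\vec\gamma$, and $\vec\alpha'=\kappa\vec\beta$, $\vec\gamma'=\tau\vec\beta$,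 $\vec\beta'=-\tau\vec\alpha-\kappa\vec\gamma$, where $'=d/ds$. The parameter $s$ is called the arc length parameter. Subscripts $a$, $b$ indicate the data of $\vec a(s_a)$, $\vec b(s_b)$. Null similar curves with variable transformation: $\vec a(s_a)$ and $\vec b(s_b)$ are so called if there is a variable transformation (change of parameter) $s_a=\int\lambda_b^a(s_b)\,ds_b$ such that $\vec\alpha_a(s_a)=\vec\alpha_b(s_b)$ for all corresponding values of the parameters. The integrals defining $\varphi_a,\varphi_b$ are antiderivatives.
   Formalization: ''Null similar'' is read up to a rigid motion: some image of a under a Lorentz isometry of determinant 1 plus a translation is null similar to b, since with literally equal tangents the ''if'' part fails (take b the image of a under diag(-1,-1,1)). *)

(* Defs.v *)
From HB Require Import structures.
From mathcomp Require Import all_boot all_order all_algebra.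
From mathcomp Require Import all_classical all_reals all_analysis.

Set Implicit Arguments.
Unset Strict Implicit.
Unset Printing Implicit Defensive.

Import Order.TTheory GRing.Theory Num.Theory.
Import numFieldNormedType.Exports.

Local Open Scope classical_set_scope.
Local Open Scope ring_scope.

Section LorentzSpace.
Variable R : realType.
Implicit Types x y : 'rV[R]_3.

(* Coordinates are numbered from 0, so x_1 (the timelike one) is [x 0 0]. *)
Definition lorentz x y : R :=
  - (x 0 0 * y 0 0) + x 0 1 * y 0 1 + x 0 2 * y 0 2.

Definition vprod x y : 'rV[R]_3 :=
  \row_j [:: x 0 1 * y 0 2 - x 0 2 * y 0 1;
             x 0 0 * y 0 2 - x 0 2 * y 0 0;
             x 0 1 * y 0 0 - x 0 0 * y 0 1]`_j.

(* Linear parts of the orientation-preserving isometries, acting on row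
   vectors from the right.  The condition on the determinant is what makes
   them commute with [vprod]. *)
Definition proper_lorentz (A : 'M[R]_3) : Prop :=
  (forall x y, lorentz (x *m A) (y *m A) = lorentz x y) /\ \det A = 1.

End LorentzSpace.

Section NullCurves.
Variable R : realType.

(* The values of the functions outside of [dom] are irrelevant. *)
Record cartan_null_curve := CartanNullCurve {
  dom : set R;
  pos : R -> 'rV[R]_3;
  alpha : R -> 'rV[R]_3;
  gamma : R -> 'rV[R]_3;
  beta : R -> 'rV[R]_3;
  kappa : R -> R;
  tau : R -> R;
  dom_open : open dom;
  dom_interval : is_interval dom;
  dom_nonempty : dom !=set0;
  kappa_continuous : forall s, dom s -> {for s, continuous kappa};
  tau_continuous : forall s, dom s -> {for s, continuous tau};
  pos_derive : forall s, dom s -> is_derive s 1 pos (alpha s);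
  alpha_null : forall s, dom s -> lorentz (alpha s) (alpha s) = 0;
  gamma_null : forall s, dom s -> lorentz (gamma s) (gamma s) = 0;
  beta_unit : forall s, dom s -> lorentz (beta s) (beta s) = 1;
  alpha_gamma : forall s, dom s -> lorentz (alpha s) (gamma s) = 1;
  beta_vprod : forall s, dom s -> beta s = vprod (alpha s) (gamma s);
  alpha_derive : forall s, dom s ->
    is_derive s 1 alpha (kappa s *: beta s);
  gamma_derive : forall s, dom s ->
    is_derive s 1 gamma (tau s *: beta s);
  beta_derive : forall s, dom s ->
    is_derive s 1 beta (- tau s *: alpha s - kappa s *: gamma s)
}.

Definition antiderivative (I : set R) (g G : R -> R) : Prop :=
  forall s, I s -> is_derive s 1 G (g s).

(* The change of parameter s_a = f s_b, with f an antiderivative of lambda: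
   a C^1 diffeomorphism of [Ib] onto [Ia]. *)
Definition variable_transformation (Ib Ia : set R) (lambda f : R -> R) : Prop :=
  [/\ set_bij Ib Ia f,
      antiderivative Ib lambda f,
      forall s, Ib s -> {for s, continuous lambda}
    & forall s, Ib s -> lambda s != 0].

Definition null_similar (a b : cartan_null_curve) : Prop :=
  exists lambda f : R -> R,
    variable_transformation (dom b) (dom a) lambda f /\
    forall s, dom b s -> alpha a (f s) = alpha b s.

(* No condition on the frames: where the curvature is nonzero, the Cartan
   frame is determined by the curve. *)
Definition congruent (a a' : cartan_null_curve) : Prop :=
  dom a' = dom a /\
  exists (A : 'M[R]_3) (v : 'rV[R]_3),
    proper_lorentz A /\ forall s, dom a s -> pos a' s = pos a s *m A + v.

(* Curvature and torsion determine a curve only up to a rigid motion, whereas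
   [null_similar] is not invariant under moving one of the two curves: a curve
   and its image under diag(-1, -1, 1) have the same curvature and torsion, but
   the timelike components of their tangents have opposite signs. *)
Definition null_similar_up_to_motion (a b : cartan_null_curve) : Prop :=
  exists a' : cartan_null_curve, congruent a a' /\ null_similar a' b.

Lemma null_similar_motion a b : null_similar a b -> null_similar_up_to_motion a b.
Proof.
move=> ab; exists a; split=> //; split=> //.
exists 1%:M, 0; split=> [|s _]; last by rewrite mulmx1 addr0.
by split=> [x y|]; rewrite ?mulmx1 ?det1.
Qed.

Definition equal_total_curvatures (a b : cartan_null_curve) (f : R -> R) : Prop :=
  exists phi_a phi_b : R -> R,
    [/\ antiderivative (dom a) (kappa a) phi_a,
        antiderivative (dom b) (kappa b) phi_b
      & forall s, dom b s -> phi_b s = phi_a (f s)].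

End NullCurves.

(* Main.v *)
(* The rows [alpha], [gamma], [beta] of a Cartan frame form a matrix with a fixed
   Gram matrix and determinant -1, and the frame is determined by [alpha] together
   with the product of the curvature and [beta].  So equality of the tangents under
   [s_a = f s_b] forces equality of the frames, and differentiating them gives
   [kappa b = f' * kappa a] and [tau b = f' * tau a].  Conversely these two
   relations, which express equality of the total curvatures and of the ratios,
   say that the two frames solve the same linear equation, hence differ by a
   constant proper Lorentz matrix. *)
Require Import Defs.
From HB Require Import structures.
From mathcomp Require Import all_boot all_order all_algebra.
From mathcomp Require Import all_classical all_reals all_analysis.
From mathcomp Require Import ring lra.

Set Implicit Arguments.
Unset Strict Implicit.
Unset Printing Implicit Defensive.

Import Order.TTheory GRing.Theory Num.Theory.
Import numFieldNormedType.Exports.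

Local Open Scope classical_set_scope.
Local Open Scope ring_scope.

(** * Lorentz algebra of three-dimensional null frames *)

Lemma ord3E (P : 'I_3 -> Prop) : P 0 -> P 1 -> P 2 -> forall i, P i.
Proof.
move=> P0 P1 P2 [[|[|[|//]]] i3].
- by have -> : Ordinal i3 = 0 by exact: val_inj.
- by have -> : Ordinal i3 = 1 by exact: val_inj.
- by have -> : Ordinal i3 = 2 by exact: val_inj.
Qed.

Lemma sum3E (V : nmodType) (F : 'I_3 -> V) : \sum_i F i = F 0 + F 1 + F 2.
Proof.
rewrite !big_ord_recl big_ord0 addr0 addrA.
by congr (_ + F _ + F _); exact: val_inj.
Qed.

Section Lorentz.
Variable R : realType.
Implicit Types (x y z u v : 'rV[R]_3) (A F G : 'M[R]_3).

Lemma row3P u v : u 0 0 = v 0 0 -> u 0 1 = v 0 1 -> u 0 2 = v 0 2 -> u = v.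
Proof. by move=> u0 u1 u2; apply/rowP; exact: ord3E. Qed.

Lemma vprod0 x y : vprod x y 0 0 = x 0 1 * y 0 2 - x 0 2 * y 0 1.
Proof. by rewrite mxE. Qed.

Lemma vprod1 x y : vprod x y 0 1 = x 0 0 * y 0 2 - x 0 2 * y 0 0.
Proof. by rewrite mxE. Qed.

Lemma vprod2 x y : vprod x y 0 2 = x 0 1 * y 0 0 - x 0 0 * y 0 1.
Proof. by rewrite mxE. Qed.

Definition vprodE := (vprod0, vprod1, vprod2).

Lemma lorentzC x y : lorentz x y = lorentz y x.
Proof. by rewrite /lorentz; ring. Qed.

Lemma lorentzDr x y z : lorentz x (y + z) = lorentz x y + lorentz x z.
Proof. by rewrite /lorentz !mxE; ring. Qed.

Lemma lorentzDl x y z : lorentz (y + z) x = lorentz y x + lorentz z x.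
Proof. by rewrite /lorentz !mxE; ring. Qed.

Lemma lorentzZr (k : R) x y : lorentz x (k *: y) = k * lorentz x y.
Proof. by rewrite /lorentz !mxE; ring. Qed.

Lemma lorentzZl (k : R) x y : lorentz (k *: x) y = k * lorentz x y.
Proof. by rewrite /lorentz !mxE; ring. Qed.

Lemma lorentz_inj u v : (forall z, lorentz u z = lorentz v z) -> u = v.
Proof.
move=> uv; apply: row3P.
- by have := uv (delta_mx 0 0); rewrite /lorentz !mxE /=; lra.
- by have := uv (delta_mx 0 1); rewrite /lorentz !mxE /=; lra.
- by have := uv (delta_mx 0 2); rewrite /lorentz !mxE /=; lra.
Qed.

Definition rows3 x y z : 'M[R]_3 := \matrix_i nth 0 [:: x; y; z] i.

Lemma rows3_mul x y z A : rows3 x y z *m A = rows3 (x *m A) (y *m A) (z *m A).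
Proof. by apply/row_matrixP; apply: ord3E; rewrite row_mul !rowK. Qed.

Lemma rows3_inj x y z u v w : rows3 x y z = rows3 u v w -> [/\ x = u, y = v & z = w].
Proof.
move=> e; split.
- by have := congr1 (row 0) e; rewrite !rowK.
- by have := congr1 (row 1) e; rewrite !rowK.
- by have := congr1 (row 2) e; rewrite !rowK.
Qed.

(** Ties [vprod] to the form through the triple product, so that compatibility of a matrix with
    [vprod] can be read off its determinant. *)
Lemma det_rows3 x y z : \det (rows3 x y z) = - lorentz (vprod x y) z.
Proof.
have sum2E (F : 'I_2 -> R) : \sum_i F i = F 0 + F 1.
  by rewrite !big_ord_recl big_ord0 addr0; congr (_ + F _); exact: val_inj.
have e20 : lift 2 0 = 0 :> 'I_3 by exact: val_inj.
have e21 : lift 2 1 = 1 :> 'I_3 by exact: val_inj.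
have e00 : lift 0 0 = 1 :> 'I_3 by exact: val_inj.
have e01 : lift 0 1 = 2 :> 'I_3 by exact: val_inj.
have e10 : lift 1 0 = 0 :> 'I_3 by exact: val_inj.
have e11 : lift 1 1 = 2 :> 'I_3 by exact: val_inj.
have l0 : lift 0 0 = 1 :> 'I_2 by exact: val_inj.
have l1 : lift 1 0 = 0 :> 'I_2 by exact: val_inj.
rewrite (expand_det_row _ 2) sum3E /cofactor.
rewrite !(expand_det_row _ 0) !sum2E /cofactor !det_mx11.
rewrite !mxE !(l0, l1, e20, e21, e00, e01, e10, e11) /lorentz !vprodE /=.
by rewrite !(modn_small, expr0, expr1, expr2) //=; ring.
Qed.

Definition eta_mx : 'M[R]_3 := diag_mx (\row_j [:: -1; 1; 1]`_j).

Lemma lorentz_mx x y : lorentz x y = (x *m eta_mx *m y^T) 0 0.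
Proof.
by rewrite mul_mx_diag !mxE sum3E !mxE /lorentz /=; ring.
Qed.

Lemma lorentz_rows m n (F : 'M[R]_(m, 3)) (G : 'M[R]_(n, 3)) i j :
  lorentz (row i F) (row j G) = (F *m eta_mx *m G^T) i j.
Proof.
rewrite lorentz_mx !mul_mx_diag !mxE; apply: eq_bigr => k _.
by rewrite !mxE.
Qed.

Definition null_frame x y z :=
  [/\ lorentz x x = 0, lorentz y y = 0, lorentz x y = 1 & z = vprod x y].

Section NullFrame.
Variables x y z : 'rV[R]_3.
Hypothesis xyz : null_frame x y z.

Lemma null_frame_xz : lorentz x z = 0.
Proof. by have [_ _ _ ->] := xyz; rewrite /lorentz !vprodE; ring. Qed.

Lemma null_frame_yz : lorentz y z = 0.
Proof. by have [_ _ _ ->] := xyz; rewrite /lorentz !vprodE; ring. Qed.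

Lemma null_frame_zz : lorentz z z = 1.
Proof.
have [xx yy xy ->] := xyz.
(* Lagrange's identity in Lorentz signature: the sign is opposite to the Euclidean one. *)
transitivity (lorentz x y ^+ 2 - lorentz x x * lorentz y y).
  by rewrite /lorentz !vprodE; ring.
by rewrite xx yy xy mul0r subr0 expr1n.
Qed.

Lemma det_null_frame : \det (rows3 x y z) = -1.
Proof.
by have [_ _ _ e] := xyz; rewrite det_rows3 -e null_frame_zz.
Qed.

(** The right-hand side is the permutation matrix exchanging the first two basis vectors, the same
    for all null frames. *)
Lemma null_frame_gram :
  rows3 x y z *m eta_mx *m (rows3 x y z)^T =
  rows3 (delta_mx 0 1) (delta_mx 0 0) (delta_mx 0 2).
Proof.
have [xx yy xy _] := xyz.
have [[xz yz] zz] := (null_frame_xz, null_frame_yz, null_frame_zz).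
by apply/matrixP; apply: ord3E; apply: ord3E; rewrite -lorentz_rows !rowK !mxE
  /= ?mxE ?[lorentz y x]lorentzC ?[lorentz z _]lorentzC.
Qed.

(** Since the Gram matrix exchanges the two null vectors, exchanging them in one factor turns it
    into the identity; this gives an explicit inverse of the frame matrix. *)
Lemma null_frame_inv : rows3 x y z *m (eta_mx *m (rows3 y x z)^T) = 1%:M.
Proof.
have [xx yy xy _] := xyz.
have [[xz yz] zz] := (null_frame_xz, null_frame_yz, null_frame_zz).
by rewrite mulmxA; apply/matrixP; apply: ord3E; apply: ord3E;
  rewrite -lorentz_rows !rowK !mxE /= ?[lorentz y x]lorentzC ?[lorentz z _]lorentzC.
Qed.

Lemma null_frame_decomposition v :
  v = lorentz v y *: x + lorentz v x *: y + lorentz v z *: z.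
Proof.
rewrite -[LHS]mulmx1 -(mulmx1C null_frame_inv) 2!mulmxA mulmx_sum_row sum3E.
by rewrite -!lorentz_rows !rowK !row_id.
Qed.

End NullFrame.

(* The vector [z] is the only one of length 1 in its direction up to sign, and
   [y] is the null vector orthogonal to [z] with [lorentz x y = 1]; the sign of
   [z] is then that of [vprod x y]. *)
Lemma null_frame_unique x y z y' z' (k k' : R) :
  null_frame x y z -> null_frame x y' z' -> k != 0 -> k *: z = k' *: z' ->
  [/\ y = y', z = z' & k = k'].
Proof.
move=> fr fr' k0 kz.
have [xx yy xy zE] := fr; have [_ yy' xy' zE'] := fr'.
have yz' : lorentz y' z = 0.
  apply: (mulfI k0); rewrite mulr0 -lorentzZr kz lorentzZr.
  by rewrite (null_frame_yz fr') mulr0.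
have y'E : y' = lorentz y' y *: x + y.
  by rewrite {1}(null_frame_decomposition fr y') yz' [lorentz y' x]lorentzC
    xy' scale1r scale0r addr0.
have yy0 : lorentz y' y = 0.
  move: yy'; rewrite {1 2}y'E !(lorentzDl, lorentzDr, lorentzZl, lorentzZr).
  by rewrite xx yy xy [lorentz y x]lorentzC xy; lra.
have ey : y = y' by rewrite y'E yy0 scale0r add0r.
have ez : z = z' by rewrite zE zE' ey.
split => //; have := null_frame_zz fr => zz.
by have := congr1 (lorentz z) kz; rewrite !lorentzZr -ez zz !mulr1.
Qed.

(** A linear map that preserves the inner products of the vectors of one basis preserves the
    form. *)
Lemma lorentz_mul_frame F A : F \in unitmx ->
  (F *m A) *m eta_mx *m (F *m A)^T = F *m eta_mx *m F^T ->
  A *m eta_mx *m A^T = eta_mx.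
Proof.
move=> uF; rewrite trmx_mul -!mulmxA => /(can_inj (mulKmx uF)).
rewrite !mulmxA => /(can_inj (mulmxK _)); apply.
by rewrite unitmx_tr.
Qed.

(** Null frames share their Gram matrix, which makes [A] an isometry, and their determinant -1,
    which makes [\det A] equal to 1. *)
Lemma null_frame_motion x y z x' y' z' A :
  null_frame x y z -> null_frame x' y' z' ->
  rows3 x y z *m A = rows3 x' y' z' -> proper_lorentz A.
Proof.
move=> fr fr' FA; split; last first.
  have := congr1 determinant FA.
  rewrite det_mulmx !(det_null_frame fr, det_null_frame fr').
  by rewrite mulN1r => /oppr_inj.
have uF : rows3 x y z \in unitmx.
  by rewrite unitmxE det_null_frame// unitrN1.
move=> u v; rewrite !lorentz_mx trmx_mul.
rewrite -[in RHS](@lorentz_mul_frame (rows3 x y z) A) ?mulmxA//.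
by rewrite FA (null_frame_gram fr) (null_frame_gram fr').
Qed.

(** By nondegeneracy it suffices to pair both sides with vectors of the form [w *m A]; by
    [det_rows3] the pairings are then determinants, which [A] leaves unchanged. *)
Lemma proper_lorentz_vprod A x y : proper_lorentz A ->
  vprod (x *m A) (y *m A) = vprod x y *m A.
Proof.
move=> [lA dA]; apply: lorentz_inj => z.
have uA : A \in unitmx by rewrite unitmxE dA unitr1.
rewrite -[z](mulmxKV uA) lA; set w := z *m _.
by apply: oppr_inj; rewrite -!det_rows3 -rows3_mul det_mulmx dA mulr1.
Qed.

End Lorentz.

(** * Derivatives of vector functions and antiderivatives on intervals *)

Lemma is_derive_mxP (R : realFieldType) (V : normedModType R) (m n : nat)
    (M : V -> 'M[R]_(m, n)) (t v : V) (D : 'M[R]_(m, n)) :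
  is_derive t v M D <-> forall i j, is_derive t v (fun x => M x i j) (D i j).
Proof.
split=> [[Mtv <-] i j|MD].
  rewrite derive_mx// mxE.
  exact: DeriveDef (iffLR (derivable_mxP _ _ _) Mtv i j) erefl.
have Mtv : derivable M t v by apply/derivable_mxP => i j; have [] := MD i j.
apply: DeriveDef => //; rewrite derive_mx//; apply/matrixP => i j.
by rewrite mxE; have [] := MD i j.
Qed.

Lemma is_derive_mulmxr (R : realFieldType) (V : normedModType R) (m n p : nat)
    (M : V -> 'M[R]_(m, n)) (t v : V) (D : 'M[R]_(m, n)) (A : 'M[R]_(n, p)) :
  is_derive t v M D -> is_derive t v (fun x => M x *m A) (D *m A).
Proof.
move=> /is_derive_mxP MD; apply/is_derive_mxP => i j.
have -> : (fun x => (M x *m A) i j) = \sum_k (A k j \*: (fun x => M x i k)).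
  apply/funext => x; rewrite fct_sumE mxE; apply: eq_bigr => k _.
  by rewrite mulrC.
have -> : (D *m A) i j = \sum_k A k j *: D i k.
  by rewrite mxE; apply: eq_bigr => k _; rewrite mulrC.
exact: is_derive_sum.
Qed.

Section RealFunctions.
Variable R : realType.
Implicit Types (I : set R) (f g : R -> R).

Lemma is_derive_mx_comp m n (V : R -> 'M[R]_(m, n)) f (s l : R)
    (D : 'M[R]_(m, n)) :
  is_derive (f s) 1 V D -> is_derive s 1 f l ->
  is_derive s 1 (V \o f) (l *: D).
Proof.
move=> /is_derive_mxP VD fl; apply/is_derive_mxP => i j.
rewrite mxE mulrC; exact: (is_derive1_comp (VD i j) fl).
Qed.

Lemma is_derive_eq_on (W : normedModType R) I (f g : R -> W) (s : R) (u v : W) :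
  open I -> I s -> (forall t, I t -> f t = g t) ->
  is_derive s 1 f u -> is_derive s 1 g v -> u = v.
Proof.
move=> oI Is fg [_ <-] [_ <-]; apply: near_eq_derive.
by near=> t; apply: fg; near: t; exact: open_nbhs_nbhs.
Unshelve. all: by end_near. Qed.

Lemma is_derive0_cst I f :
  is_interval I -> (forall s, I s -> is_derive s 1 f 0) ->
  forall s t, I s -> I t -> f s = f t.
Proof.
move=> itvI f0.
suff le s t : s <= t -> I s -> I t -> f s = f t.
  by move=> s t Is It; case: (leP s t) => [/le->|/ltW/le->].
move=> st Is It.
have sub x : x \in `[s, t] -> I x.
  by rewrite in_itv /= => /andP[sx xt]; apply: (itvI s t) => //; rewrite sx.
have f0' x : x \in `]s, t[ -> is_derive x 1 f 0.
  by move=> /subset_itv_oo_cc/sub; exact: f0.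
have [|x _] := @MVT_segment _ f (fun=> 0) s t st f0'.
  apply: derivable_within_continuous => x /sub/f0 fx.
  by have [] := fx.
by rewrite mul0r => /eqP; rewrite subr_eq0 => /eqP.
Qed.

(** The fundamental theorem of calculus is applied on a segment [[p, q]] contained in [I], with both
    the base point [c] and the given point [s] in its interior. *)
Lemma antiderivative_exists I g : open I -> is_interval I ->
  (forall s, I s -> {for s, continuous g}) ->
  exists G, antiderivative I g G.
Proof.
move=> oI itvI cg.
have [->|/set0P[c Ic]] := eqVneq I set0; first by exists g.
pose mu := @lebesgue_measure R.
(* The signed integral from [c] to [x]: in each case one of the two domains is empty or a single
   point. *)
pose G x := \int[mu]_(t in `[c, x]) g t - \int[mu]_(t in `[x, c]) g t.
exists G => s Is.
have ex_lt x : I x -> exists2 p, p < x & I p.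
  move=> Ix; have /nbhs_ballP[e /= e0 xe] : nbhs x I by exact: open_nbhs_nbhs.
  exists (x - e / 2); first by rewrite gtrBl divr_gt0.
  apply: xe; rewrite /ball /= opprB addrC subrK gtr0_norm ?divr_gt0//; lra.
have ex_gt x : I x -> exists2 p, x < p & I p.
  move=> Ix; have /nbhs_ballP[e /= e0 xe] : nbhs x I by exact: open_nbhs_nbhs.
  exists (x + e / 2); first by rewrite ltrDl divr_gt0.
  apply: xe; rewrite /ball /= opprD addNKr normrN gtr0_norm ?divr_gt0//; lra.
have [p] : exists2 p, p < Num.min s c & I p.
  by apply: ex_lt; rewrite /Num.min; case: ifP.
rewrite lt_min => /andP[ps pc] Ip.
have [q] : exists2 q, Num.max s c < q & I q.
  by apply: ex_gt; rewrite /Num.max; case: ifP.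
rewrite gt_max => /andP[sq cq] Iq.
have ig x y : p <= x -> y <= q -> mu.-integrable `[x, y] (EFin \o g).
  move=> px yq; apply: continuous_compact_integrable; first exact: segment_compact.
  apply: continuous_in_subspaceT => t; rewrite inE/= in_itv/= => /andP[xt ty].
  apply: cg; apply: itvI Ip Iq _ _; apply/andP.
  by split; [exact: le_trans xt|exact: le_trans ty _].
have split_int x y : p <= x -> x <= y -> y <= q ->
    \int[mu]_(t in `[x, y]) g t =
    \int[mu]_(t in `[p, y]) g t - \int[mu]_(t in `[p, x]) g t.
  move=> px xy yq; rewrite Rintegral_itvB ?bnd_simp//; last exact: ig.
  rewrite Rintegral_itv_obnd_cbnd//.
  apply: (integrableS _ _ _ (ig x y px yq)) => //.
  by apply: subset_itvr; rewrite bnd_simp.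
have int0 x y : y <= x -> \int[mu]_(t in `[x, y]) g t = 0.
  rewrite le_eqVlt => /predU1P[->|yx]; first by rewrite set_itv1 Rintegral_set1.
  by rewrite set_itv_ge ?Rintegral_set0// bnd_simp -ltNge.
(* On [[p, q]], [G] differs by a constant from the integral starting at [p]. *)
have GE x : p <= x -> x <= q ->
    G x = \int[mu]_(t in `[p, x]) g t - \int[mu]_(t in `[p, c]) g t.
  move=> px xq; rewrite /G; have [cx|/ltW xc] := leP c x.
    by rewrite (split_int c x) ?(ltW pc)// (int0 x c)// subr0.
  by rewrite (split_int x c) ?(ltW cq)// (int0 c x)// sub0r opprB.
have [dF FE] := continuous_FTC1_closed sq (ig p q (lexx p) (lexx q)) ps (cg s Is).
pose F x := \int[mu]_(t in `[p, x]) g t - \int[mu]_(t in `[p, c]) g t.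
apply: (@near_eq_is_derive _ _ _ F).
  near=> x; apply/esym/GE; apply/ltW; near: x.
    exact: lt_nbhsr.
  exact: lt_nbhsl.
rewrite -[g s]subr0; apply: is_deriveB.
by apply: DeriveDef => //; rewrite -derive1E.
Unshelve. all: by end_near. Qed.

End RealFunctions.

(** * Cartan frames under reparametrization and motion *)

Section CartanCurves.
Variable R : realType.
Implicit Types (a b : cartan_null_curve R) (l f : R -> R).

Lemma cartan_null_frame a s : dom a s ->
  null_frame (alpha a s) (gamma a s) (beta a s).
Proof.
move=> as_; split; [exact: alpha_null|exact: gamma_null|exact: alpha_gamma|].
exact: beta_vprod.
Qed.

(** Differentiating the equality of the tangents equates two multiples of the vectors [beta], to
    which [null_frame_unique] applies. *)
Lemma tangent_reparametrization a b l f :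
  (forall s, dom b s -> dom a (f s)) ->
  antiderivative (dom b) l f ->
  (forall s, dom b s -> l s * kappa a (f s) != 0) ->
  (forall s, dom b s -> alpha a (f s) = alpha b s) ->
  forall s, dom b s ->
    l s * kappa a (f s) = kappa b s /\ l s * tau a (f s) = tau b s.
Proof.
move=> fab fl lk eqal.
(* Proved on all of [dom b], so that the equality of the vectors [gamma] can be differentiated in
   turn. *)
have frames s : dom b s -> [/\ gamma a (f s) = gamma b s,
    beta a (f s) = beta b s & l s * kappa a (f s) = kappa b s].
  move=> bs; have frb := cartan_null_frame bs.
  have := cartan_null_frame (fab _ bs); rewrite eqal// => fra.
  apply: (null_frame_unique fra frb); first exact: lk.
  rewrite -scalerA; apply: (is_derive_eq_on (@dom_open _ b) bs eqal).
    apply: is_derive_mx_comp; last exact: fl.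
    by apply: alpha_derive; exact: fab.
  exact: alpha_derive.
move=> s bs; have [_ eqb ->] := frames s bs; split => //.
have eqg t : dom b t -> gamma a (f t) = gamma b t by move=> /frames[].
have e : l s *: (tau a (f s) *: beta a (f s)) = tau b s *: beta b s.
  apply: (is_derive_eq_on (@dom_open _ b) bs eqg).
    apply: is_derive_mx_comp; last exact: fl.
    by apply: gamma_derive; exact: fab.
  exact: gamma_derive.
(* Pairing with the unit vector [beta b s] extracts the scalar coefficients. *)
have := congr1 (lorentz (beta b s)) e.
by rewrite eqb !lorentzZr beta_unit// !mulr1.
Qed.

(** Transparent, so that the curvature and torsion of the image are those of [a] by conversion. *)
Definition motion a (A : 'M[R]_3) (v : 'rV[R]_3) (pA : proper_lorentz A) :
  cartan_null_curve R.
Proof.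
refine (@CartanNullCurve R (dom a) (fun s => pos a s *m A + v)
  (fun s => alpha a s *m A) (fun s => gamma a s *m A) (fun s => beta a s *m A)
  (kappa a) (tau a) (@dom_open _ a) (@dom_interval _ a) (@dom_nonempty _ a)
  (@kappa_continuous _ a) (@tau_continuous _ a) _ _ _ _ _ _ _ _ _) => s as_.
- rewrite -[alpha a s *m A]addr0; apply: is_deriveD.
  by apply: is_derive_mulmxr; exact: pos_derive.
- by rewrite pA.1 alpha_null.
- by rewrite pA.1 gamma_null.
- by rewrite pA.1 beta_unit.
- by rewrite pA.1 alpha_gamma.
- by rewrite proper_lorentz_vprod// beta_vprod.
- by rewrite scalemxAl; apply: is_derive_mulmxr; exact: alpha_derive.
- by rewrite scalemxAl; apply: is_derive_mulmxr; exact: gamma_derive.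
- rewrite !scalemxAl -mulmxBl; apply: is_derive_mulmxr; exact: beta_derive.
Defined.

(* If [G] and [F] are the matrices whose rows are the frames of [a] at [f s] and
   of [b] at [s], both satisfy the same linear equation [X' = K X] with [K]
   skew for the Gram matrix [J] of null frames, so [G^T J F] is constant;
   multiplication by [J] exchanges the rows [alpha] and [gamma]. *)
Lemma frames_motion a b l f :
  (forall s, dom b s -> dom a (f s)) ->
  antiderivative (dom b) l f ->
  (forall s, dom b s -> l s * kappa a (f s) = kappa b s) ->
  (forall s, dom b s -> l s * tau a (f s) = tau b s) ->
  exists2 A : 'M[R]_3, proper_lorentz A &
    forall s, dom b s -> alpha a (f s) *m A = alpha b s.
Proof.
move=> fab fl kab tab.
have [s0 bs0] := dom_nonempty b.
pose M s : 'M[R]_3 := (rows3 (gamma a (f s)) (alpha a (f s)) (beta a (f s)))^T *m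
  rows3 (alpha b s) (gamma b s) (beta b s).
have ME s i j : M s i j = gamma a (f s) 0 i * alpha b s 0 j +
    alpha a (f s) 0 i * gamma b s 0 j + beta a (f s) 0 i * beta b s 0 j.
  by rewrite mxE sum3E !mxE.
have Mcst s : dom b s -> M s = M s0.
  move=> bs; apply/matrixP => i j.
  apply: (@is_derive0_cst _ (dom b) (fun s => M s i j)) => //.
    exact: dom_interval.
  move=> {bs}s bs; under eq_fun do rewrite ME.
  have comp (V : R -> 'rV[R]_3) D : is_derive (f s) 1 V D ->
      is_derive s 1 (fun t => V (f t) 0 i) (l s * D 0 i).
    move=> VD; have := is_derive_mx_comp VD (fl s bs).
    by move=> /is_derive_mxP/(_ 0 i); rewrite mxE.
  have dal := comp _ _ (alpha_derive (fab _ bs)).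
  have dga := comp _ _ (gamma_derive (fab _ bs)).
  have dbe := comp _ _ (beta_derive (fab _ bs)).
  have /is_derive_mxP/(_ 0 j) dal' := alpha_derive bs.
  have /is_derive_mxP/(_ 0 j) dga' := gamma_derive bs.
  have /is_derive_mxP/(_ 0 j) dbe' := beta_derive bs.
  apply: is_derive_eq.
  (* With the data of [b] replaced by [l] times those of [a], the terms of the product rule cancel
     in pairs. *)
  rewrite !mxE -kab// -tab// /GRing.scale /=.
  by ring.
(* By [null_frame_inv], [eta_mx R *m M s] carries the frame of [a] at [f s] to that of [b] at [s];
   constancy of [M] makes this matrix independent of [s]. *)
exists (eta_mx R *m M s0).
  apply: (null_frame_motion (cartan_null_frame (fab _ bs0))
    (cartan_null_frame bs0)).
  rewrite !mulmxA -[_ *m eta_mx R *m _]mulmxA null_frame_inv ?mul1mx//.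
  exact/cartan_null_frame/fab.
move=> s bs; rewrite -(Mcst s bs).
have : rows3 (alpha a (f s)) (gamma a (f s)) (beta a (f s)) *m
    (eta_mx R *m M s) = rows3 (alpha b s) (gamma b s) (beta b s).
  rewrite !mulmxA -[_ *m eta_mx R *m _]mulmxA null_frame_inv ?mul1mx//.
  exact/cartan_null_frame/fab.
by rewrite rows3_mul => /rows3_inj[].
Qed.

End CartanCurves.

Theorem theorem3p4 (R : realType) (a b : cartan_null_curve R)
    (hka : forall s : R, dom a s -> kappa a s != 0)
    (hkb : forall s : R, dom b s -> kappa b s != 0) :
  null_similar_up_to_motion a b <->
  exists lambda f : R -> R,
    [/\ variable_transformation (dom b) (dom a) lambda f,
        equal_total_curvatures a b f
      & forall s : R, dom b s ->
          tau b s / kappa b s = tau a (f s) / kappa a (f s)].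
Proof.
split=> [[a' [[da [A [v [pA posE]]]] [l [f [[fbij fl cl l0] eqal]]]]]|].
  move: fbij; rewrite da => fbij; have [fab _ _] := fbij.
  (* Congruence relates positions only; differentiating it relates the tangents. *)
  have alE s : dom a s -> alpha a' s = alpha a s *m A.
    move=> as_; apply: (is_derive_eq_on (@dom_open _ a) as_ posE).
      by apply: pos_derive; rewrite da.
    exact: (@pos_derive _ (motion a v pA)).
  have lk s : dom b s -> l s * kappa a (f s) != 0.
    by move=> bs; rewrite mulf_neq0 ?l0// hka//; exact: fab.
  (* [motion a v pA] stands in for [a']: it has the same tangents, and its curvature and torsion are
     those of [a]. *)
  have inv := @tangent_reparametrization R (motion a v pA) b l f fab fl lk.
  have {}inv s : dom b s ->
      l s * kappa a (f s) = kappa b s /\ l s * tau a (f s) = tau b s.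
    by apply: inv => t bt /=; rewrite -alE ?eqal//; exact: fab.
  exists l, f; split=> [//||s bs].
    have [phi phiE] := antiderivative_exists (@dom_open _ a) (@dom_interval _ a)
      (@kappa_continuous _ a).
    (* With this choice the total curvatures agree by definition, and the chain rule with [inv]
       shows that [phi \o f] is an antiderivative of [kappa b]. *)
    exists phi, (phi \o f); split => // s bs.
    rewrite -(inv s bs).1 mulrC; apply: is_derive1_comp; last exact: fl.
    by apply: phiE; exact: fab.
  have [<- <-] := inv s bs; rewrite -mulf_div divff ?mul1r//; exact: l0.
move=> [l [f [vt [phia [phib [dphia dphib phiE]]] ratio]]].
have [[fab _ _] fl _ l0] := vt.
(* The derivative of the equality of total curvatures. *)
have kab s : dom b s -> l s * kappa a (f s) = kappa b s.
  move=> bs; rewrite mulrC; symmetry.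
  apply: (is_derive_eq_on (@dom_open _ b) bs phiE); first exact: dphib.
  by apply: (is_derive1_comp _ (fl s bs)); apply: dphia; exact: fab.
have tab s : dom b s -> l s * tau a (f s) = tau b s.
  move=> bs; have := ratio s bs; rewrite -kab// => e.
  have ka : kappa a (f s) != 0 by apply: hka; exact: fab.
  move/eqP: e; rewrite eqr_div ?mulf_neq0 ?l0// => /eqP e.
  by apply: (mulIf ka); rewrite e; ring.
have [A pA alE] := frames_motion fab fl kab tab.
(* Similarity involves tangents only, so the translation part can be zero. *)
exists (motion a 0 pA); split; first by split=> //; exists A, 0.
by exists l, f.
Qed.
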